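(* Let $c\in(0,\frac12)$, $k\ge 2$ and $n$ be sufficiently large. If $G$ is an $n$-vertex incomparability graph with $\varrho_k(G)\ge c$, then $G$ contains a copy of $K_k\Big[\frac{c^4 n}{10^8k^2\log n}\Big]$.
   Context: All graphs are simple and undirected, and $k$ is an integer. The incomparability graph of a partially ordered set $(P,\prec)$ is the graph with vertex set $P$ in which two vertices form an edge if and only if the corresponding elements are incomparable in $P$; an incomparability graph is a graph arising in this way. The $K_k$-density $\varrho_k(G)$ of a graph $G$ is the number of copies of $K_k$ in $G$ divided by $\binom{|G|}{k}$, where $|G|$ is the number of vertices of $G$. $K_k[t]$ is the $t$-blowup of the clique $K_k$, obtained by replacing every vertex by an independent set of size $t$ and every edge by a copy of $K_{t,t}$; that is, the complete $k$-partite graph with all parts of size $t$. Containing a copy means as a (not necessarily induced) subgraph. Floor and ceiling signs are omitted. *)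

(* Defs.v *)
From HB Require Import structures.
From mathcomp Require Import all_boot all_order all_algebra.

Set Implicit Arguments.
Unset Strict Implicit.
Unset Printing Implicit Defensive.

Import Order.TTheory GRing.Theory Num.Theory.
Local Open Scope ring_scope.

Record sgraph := SGraph {
  vertex :> finType;
  adj : rel vertex;
  adj_sym : symmetric adj;
  adj_irrefl : irreflexive adj
}.

Lemma incomparable_sym (d : Order.disp_t) (P : finPOrderType d) :
  symmetric (fun x y : P => (x >< y)%O).
Proof. by move=> x y; rewrite comparable_sym. Qed.

Lemma incomparable_irrefl (d : Order.disp_t) (P : finPOrderType d) :
  irreflexive (fun x y : P => (x >< y)%O).
Proof. by move=> x; rewrite comparablexx. Qed.

Definition incomparability_graph (d : Order.disp_t) (P : finPOrderType d) :
    sgraph :=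
  SGraph (@incomparable_sym d P) (@incomparable_irrefl d P).

Definition isomorphic (G H : sgraph) : Prop :=
  exists2 f : G -> H, bijective f & forall x y, adj (f x) (f y) = adj x y.

Definition is_incomparability_graph (G : sgraph) : Prop :=
  exists (d : Order.disp_t) (P : finPOrderType d),
    isomorphic G (incomparability_graph P).

(* Not necessarily induced. *)
Definition contains_copy (H G : sgraph) : Prop :=
  exists2 f : H -> G, injective f & forall x y, adj x y -> adj (f x) (f y).

Lemma neq_sym (T : eqType) : symmetric (fun x y : T => x != y).
Proof. by move=> x y; rewrite eq_sym. Qed.

Lemma neq_irrefl (T : eqType) : irreflexive (fun x y : T => x != y).
Proof. by move=> x; rewrite eqxx. Qed.

Definition complete_graph (k : nat) : sgraph :=
  SGraph (@neq_sym 'I_k) (@neq_irrefl 'I_k).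

Lemma blowup_sym (H : sgraph) (t : nat) :
  symmetric (fun x y : H * 'I_t => adj x.1 y.1).
Proof. by move=> x y; rewrite adj_sym. Qed.

Lemma blowup_irrefl (H : sgraph) (t : nat) :
  irreflexive (fun x y : H * 'I_t => adj x.1 y.1).
Proof. by move=> x; rewrite adj_irrefl. Qed.

Definition blowup (H : sgraph) (t : nat) : sgraph :=
  SGraph (@blowup_sym H t) (@blowup_irrefl H t).

Definition is_clique (G : sgraph) (S : {set G}) : bool :=
  [forall x in S, forall y in S, (x != y) ==> adj x y].

(* A copy of the complete graph on k vertices is determined by its vertex
   set, so copies are counted as k-element cliques. *)
Definition clique_count (k : nat) (G : sgraph) : nat :=
  #|[set S : {set G} | (#|S| == k) && is_clique S]|.

Definition clique_density (R : numFieldType) (k : nat) (G : sgraph) : R :=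
  (clique_count k G)%:R / 'C(#|G|, k)%:R.

(* Main.v *)
Require Import Defs.
From mathcomp Require Import all_boot all_order all_algebra.
From mathcomp Require Import reals exp.
From mathcomp Require Import zify ring lra.
Import Order.TTheory GRing.Theory Num.Theory.

Set Implicit Arguments.
Unset Strict Implicit.
Unset Printing Implicit Defensive.

(* Write U(x) for the up-set of x.  For an antichain x_1, ..., x_k the private
   up-sets U(x_i) minus the union of the other U(x_j) are pairwise completely
   incomparable, so we are done as soon as all of them have at least t elements.
   Otherwise every k-antichain is S u {x} with |S| = k - 1, x outside the
   up-closure of S and |U(x) \ U(S)| < t.  For a fixed S, the set Q of such x
   induces a poset in which all up-sets have fewer than t elements.  If
   |Q| >= 16 k t (log_2 n + 1), then Q contains the blow-up: at least
   16 k t elements y of Q have |D(y)| in one dyadic range [N/2, N), where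
   D(y) is the down-set of y in Q; a random set X of density 1/N meets D(y)
   in exactly one point for an eighth of these y, and grouping those y
   according to that point (groups have fewer than t elements each, and points
   of different groups are incomparable) yields k classes of size at least t.
   So the number of k-antichains is at most C(n, k-1) * 16 k t (log_2 n + 1),
   which is less than c C(n, k) for the given t. *)

(** * Random sets meeting given sets in exactly one point *)

(** Bernoulli's inequality [(1 - 1/N)^e >= 1 - e/N] with denominators cleared; truncated subtraction
    makes it trivial for [e >= N]. *)
Lemma expn_pred_bernoulli (N e : nat) : N ^ e * (N - e) <= N.-1 ^ e * N.
Proof.
elim: e => [|e IH]; first by rewrite subn0 !expn0 !mul1n.
have [leNe | /ltnW/subnK] := leqP N e.+1.
  by have -> : N - e.+1 = 0; rewrite ?muln0 //; lia.
set d := N - e.+1 => defN.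
have step : N * d <= N.-1 * (N - e).
  have -> : N - e = d.+1 by lia.
  have -> : N.-1 = d + e by lia.
  by rewrite -defN; lia.
rewrite !expnS -mulnA mulnCA.
apply: (leq_trans (leq_mul (leqnn (N ^ e)) step)).
by rewrite mulnCA -[leqRHS]mulnA leq_mul2l IH orbT.
Qed.

(** In real terms [(1 - 1/(2m))^e >= 1/4]: split [e] into two halves of size at most [m]; by
    Bernoulli each contributes a factor at least 1/2. *)
Lemma expn_double_pred (m e : nat) : e <= m.*2 -> m.*2 ^ e <= 4 * m.*2.-1 ^ e.
Proof.
have [-> | m_gt0] := posnP m; first by rewrite leqn0 => /eqP->.
have half a : a <= m -> m.*2 ^ a <= 2 * m.*2.-1 ^ a.
  move=> le_am; have := expn_pred_bernoulli m.*2 a => bern.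
  rewrite -(leq_pmul2r m_gt0).
  apply: (leq_trans (leq_mul (leqnn _) (_ : m <= m.*2 - a))); first by lia.
  by apply: (leq_trans bern); rewrite -mul2n mulnCA mulnA.
move=> le_e; have -> : e = e./2 + uphalf e by rewrite uphalf_half; lia.
rewrite !expnD.
have le1 : e./2 <= m by lia.
have le2 : uphalf e <= m by rewrite uphalf_half; lia.
by apply: leq_trans (leq_mul (half _ le1) (half _ le2)) _; rewrite mulnACA.
Qed.

(* A random set X of density 1/(a+1) has probability a^#|~: X| / (a+1)^#|T|;
   the denominators are cleared to stay in nat. *)
Lemma weighted_unique_hit (T : finType) (D : {set T}) (a : nat) :
  \sum_(X : {set T} | #|D :&: X| == 1) a ^ #|~: X|
    = #|D| * (a ^ #|D|.-1 * a.+1 ^ #|~: D|).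
Proof.
rewrite -sum_nat_const.
have -> : \sum_(X : {set T} | #|D :&: X| == 1) a ^ #|~: X| =
   \sum_(x in D) \sum_(X : {set T} | D :&: X == [set x]) a ^ #|~: X|.
  rewrite (exchange_big_dep predT) //=  big_mkcond /=.
  apply: eq_bigr => X _; case: ifP => [/cards1P[x DX] | DX1].
    rewrite (big_pred1 x) // => y; rewrite DX eqEsubset !sub1set !inE [y == x]eq_sym andbb.
    have /setIP[xD _] : x \in D :&: X by rewrite DX set11.
    by case: eqP => [<-|]; rewrite ?xD ?andbF.
  rewrite big_pred0 // => x; apply/negP => /andP[_ /eqP DX].
  by rewrite DX cards1 in DX1.
apply: eq_bigr => x xD.
(* Expanding the product of [F z + G z] picks [F z] for [z] in [X] and [G z] otherwise; the term is
   the weight of [X] if [D :&: X = [set x]], and 0 if not. *)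
pose F z : nat := (z \notin D) || (z == x).
pose G z : nat := (z != x) * a.
have FG : \prod_z (F z + G z) = a ^ #|D|.-1 * a.+1 ^ #|~: D|.
  rewrite (bigID (mem D)) /=; congr (_ * _).
    rewrite (bigD1 x) //= {1}/F {1}/G eqxx orbT mul0n addn0 mul1n.
    rewrite (eq_bigr (fun=> a)) => [|z /andP[zD zx]]; last by rewrite /F /G zD (negPf zx) mul1n.
    rewrite prod_nat_const (cardD1 x D) xD add1n /=; congr (_ ^ _).
    by apply: eq_card => z; rewrite !inE andbC.
  rewrite (eq_bigr (fun=> a.+1)) => [|z zD].
    by rewrite prod_nat_const; congr (_ ^ _); apply: eq_card => z; rewrite !inE.
  have zx : z != x by apply: contra zD => /eqP->.
  by rewrite /F /G zD zx mul1n.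
rewrite -FG bigA_distr big_mkcond /=; apply: eq_bigr => X _.
case: ifP => [/eqP DX | nDX].
  rewrite (bigID (mem X)) /= big1 => [|z zX].
    rewrite mul1n (eq_bigr (fun=> a)) => [|z zX].
      by rewrite prod_nat_const; congr (_ ^ _); apply: eq_card => z; rewrite !inE.
    rewrite (negPf zX) /G; have -> : z != x; last by rewrite mul1n.
    apply: contra zX => /eqP->.
    by have /setIP[] : x \in D :&: X by rewrite DX set11.
  rewrite zX /F -in_set1 -DX inE zX andbT orNb //.
apply/esym/eqP; rewrite prod_nat_seq_eq0 /=; apply/hasP.
have [z] : exists z, (z \in D :&: X) != (z \in [set x]).
  apply/existsP; apply: contraFT nDX => /existsPn h.
  by apply/eqP/setP => z; have := h z; rewrite negbK => /eqP.
rewrite !inE => zDX; exists z; first by rewrite mem_index_enum.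
move: zDX; have [-> | zx] := eqVneq z x.
  by rewrite xD /= /G eqxx; case: ifP.
by rewrite eqbF_neg negbK => /andP[zD ->]; rewrite /F zD (negPf zx).
Qed.

Lemma weighted_subsets (T : finType) (a : nat) :
  \sum_(X : {set T}) a ^ #|~: X| = a.+1 ^ #|T|.
Proof.
rewrite -[#|T|]/#|predT| -prod_nat_const (eq_bigr (fun=> 1 + a)) //.
rewrite bigA_distr; apply: eq_bigr => X _.
rewrite (bigID (mem X)) /= big1 ?mul1n => [|z ->] //.
rewrite (eq_bigr (fun=> a)) => [|z /negPf-> //].
by rewrite prod_nat_const; congr (_ ^ _); apply: eq_card => z; rewrite !inE.
Qed.

(** Average over a random [X] of density [1/(2m)], [m = 2 ^ j]: a set of size d in [[m, 2m)] is hit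
    exactly once with probability [d/(2m) * (1 - 1/(2m))^(d-1) >= 1/2 * 1/4]. *)
Lemma unique_hit_dyadic (T : finType) (Y : {set T}) (D : T -> {set T}) (j : nat) :
  (forall y, y \in Y -> 2 ^ j <= #|D y| < 2 ^ j.+1) ->
  exists X : {set T}, #|Y| <= 8 * #|[set y in Y | #|D y :&: X| == 1]|.
Proof.
move=> dyadic; pose hit X := [set y in Y | #|D y :&: X| == 1].
apply/existsP; apply: contraT => /existsPn/= few.
pose m := 2 ^ j; have m_gt0 : 0 < m by rewrite expn_gt0.
pose a := m.*2.-1; have Na : a.+1 = m.*2 by rewrite prednK ?double_gt0.
have Y_gt0 : 0 < #|Y|.
  by have := few set0; rewrite -ltnNge; apply: leq_ltn_trans.
have upper : \sum_(X : {set T}) a ^ #|~: X| * (8 * #|hit X|) <= m.*2 ^ #|T| * #|Y|.-1.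
  rewrite -Na -weighted_subsets big_distrl; apply: leq_sum => X _.
  rewrite leq_mul2l; apply/orP; right.
  by rewrite -ltnS prednK // ltnNge few.
have lower : m.*2 ^ #|T| * #|Y| <= \sum_(X : {set T}) a ^ #|~: X| * (8 * #|hit X|).
  have -> : \sum_(X : {set T}) a ^ #|~: X| * (8 * #|hit X|) =
      \sum_(y in Y) 8 * \sum_(X : {set T} | #|D y :&: X| == 1) a ^ #|~: X|.
    rewrite -big_distrr (exchange_big_dep predT) //= big_distrr /=.
    apply: eq_bigr => X _; rewrite sum_nat_const mulnCA; congr (_ * _).
    by rewrite mulnC; congr (_ * _); apply: eq_card => y; rewrite !inE.
  rewrite mulnC -sum_nat_const; apply: leq_sum => y /dyadic.
  rewrite expnS mul2n -/m weighted_unique_hit => /andP[le_d lt_d].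
  rewrite -(cardsC (D y)) expnD Na -/a !mulnA leq_mul2r; apply/orP; right.
  have d_gt0 : 0 < #|D y| by apply: leq_trans le_d.
  rewrite -[X in m.*2 ^ X](prednK d_gt0) expnS.
  have := @expn_double_pred m #|D y|.-1; rewrite -/a => /(_ _).
  move=> /(_ (leq_trans (leq_pred _) (ltnW lt_d))) bound.
  apply: (leq_trans (leq_mul (leqnn _) bound)).
  by rewrite mulnA leq_mul2r; apply/orP; right; lia.
have := leq_trans lower upper; rewrite leq_mul2l expn_eq0 double_eq0.
by rewrite (gtn_eqF m_gt0) /=; case: #|Y| Y_gt0 => //= n _; rewrite ltnn.
Qed.

(** * Dyadic pigeonhole and greedy grouping *)

Lemma dyadic_class (T : finType) (Q : {set T}) (d : T -> nat) (n : nat) :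
  (forall y, y \in Q -> d y <= n) ->
  exists j, #|Q| <= (trunc_log 2 n).+1 * #|[set y in Q | trunc_log 2 (d y) == j]|.
Proof.
move=> d_le; set l := (trunc_log 2 n).+1.
pose s (i : 'I_l) := #|[set y in Q | trunc_log 2 (d y) == i]|.
have [i0 _ i0_max] := @arg_maxnP _ (ord0 : 'I_l) predT s isT.
exists (val i0); rewrite -[X in X * _](card_ord l) -sum_nat_const.
rewrite -sum1_card (partition_big (fun y => inord (trunc_log 2 (d y)) : 'I_l) predT) //=.
apply: leq_sum => i _; apply: (@leq_trans (s i)).
  rewrite sum1dep_card subset_leq_card //; apply/subsetP => y.
  rewrite !inE => /andP[yQ /eqP <-]; rewrite yQ inordK ?eqxx //.
  by rewrite ltnS leq_trunc_log // d_le.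
exact: i0_max.
Qed.

(** Greedy: a minimal set [A] of values whose fibres jointly hold at least [t] points holds at most
    [2 * t], since dropping one value loses at most [t]. It forms one class; recurse on the rest. *)
Lemma group_fibres (T : finType) (t k : nat) (h : T -> T) (S : {set T}) :
  (forall x, #|[set y in S | h y == x]| <= t) ->
  2 * k * t <= #|S| ->
  exists g : T -> nat, forall i, i < k -> t <= #|[set y in S | g (h y) == i]|.
Proof.
elim: k S => [|k IH] S fibre le_S; first by exists (fun=> 0).
pose P (A : {set T}) := t <= #|[set y in S | h y \in A]|.
have [A /minsetP[PA minA] _] : {A | minset P A & A \subset setT}.
  apply: minset_exists; rewrite /P.
  have -> : [set y in S | h y \in setT] = S by apply/setP => y; rewrite !inE andbT.
  by lia.
have A_le : #|[set y in S | h y \in A]| <= 2 * t.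
  have [A0 | [x xA]] := set_0Vmem A.
    by rewrite (_ : [set y in S | h y \in A] = set0) ?cards0 //; apply/setP => y; rewrite A0 !inE andbF.
  have : ~~ P (A :\ x).
    apply/negP => /minA/(_ (subD1set A x)) Ax.
    by move: xA; rewrite -Ax !inE eqxx.
  rewrite /P -ltnNge => lt_t.
  have /subset_leq_card : [set y in S | h y \in A] \subset
      [set y in S | h y \in A :\ x] :|: [set y in S | h y == x].
    by apply/subsetP => y; rewrite !inE => /andP[-> ->]; case: (h y == x).
  have [] := leq_card_setU [set y in S | h y \in A :\ x] [set y in S | h y == x].
  have := fibre x; lia.
pose S' := [set y in S | h y \notin A].
have cardS' : #|[set y in S | h y \in A]| + #|S'| = #|S|.
  rewrite -(cardsID [set y | h y \in A] S); congr (_ + _).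
    by apply: eq_card => y; rewrite !inE.
  by apply: eq_card => y; rewrite !inE andbC.
have [x | | g Pg] := IH S'.
- apply: leq_trans (fibre x); apply: subset_leq_card; apply/subsetP => y.
  by rewrite !inE => /andP[/andP[-> _]].
- by lia.
exists (fun x => if x \in A then k else g x) => i.
rewrite ltnS leq_eqVlt => /predU1P[-> | lt_ik].
  apply: leq_trans PA _; apply: subset_leq_card; apply/subsetP => y.
  by rewrite !inE => /andP[-> ->] /=.
apply: leq_trans (Pg i lt_ik) _; apply: subset_leq_card; apply/subsetP => y.
by rewrite !inE => /andP[/andP[-> /negPf->] /=].
Qed.

(** * Thick antichains in finite orders *)

(** The blow-up in order terms. As [i], [j] run over ordered pairs, the one-sided [~~ r x y] gives
    incomparability; for reflexive [r] it also makes the classes disjoint. *)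
Definition thick_antichain (T : finType) (r : rel T) (k t : nat) : Prop :=
  exists2 A : nat -> {set T}, forall i, i < k -> t <= #|A i| &
    forall i j x y, i < k -> j < k -> i != j ->
      x \in A i -> y \in A j -> ~~ r x y.

Lemma thick_antichain_of_small_upsets (T : finType) (r : rel T) (k t : nat)
    (Q : {set T}) :
  reflexive r -> transitive r ->
  (forall x, x \in Q -> #|[set y in Q | r x y]| <= t) ->
  16 * k * t * (trunc_log 2 #|T|).+1 <= #|Q| ->
  thick_antichain r k t.
Proof.
move=> r_refl r_trans small le_Q.
pose D y := [set x in Q | r x y].
have D_le y : y \in Q -> #|D y| <= #|T| by move=> _; apply: max_card.
have [j le_Qj] := dyadic_class D_le.
set Y := [set y in Q | _] in le_Qj.
have [|X le_Y] := @unique_hit_dyadic T Y D j.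
  move=> y; rewrite inE => /andP[yQ /eqP <-]; apply: trunc_log_bounds => //.
  by apply/card_gt0P; exists y; rewrite inE yQ r_refl.
set S := [set y in Y | _] in le_Y.
(* For [y] in [S], [h y] is the unique point of [X] in [D y]; the default is never reached there. *)
pose h y := odflt y [pick x in D y :&: X].
have hE y : y \in S -> D y :&: X = [set h y].
  rewrite inE => /andP[_ /cards1P[x DX]]; rewrite DX /h DX.
  case: pickP => [z /set1P-> // | /(_ x)]; by rewrite set11.
have hP y : y \in S -> [&& h y \in Q, r (h y) y & h y \in X].
  move=> /hE DX; have : h y \in D y :&: X by rewrite DX set11.
  by rewrite !inE andbA.
have [x | | g Pg] := @group_fibres T t k h S.
- have [-> | [y]] := set_0Vmem [set y in S | h y == x]; first by rewrite cards0.
  rewrite inE => /andP[yS /eqP hy].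
  have /and3P[] := hP _ yS; rewrite hy => xQ _ _.
  apply: leq_trans (small x xQ); apply: subset_leq_card; apply/subsetP => z.
  rewrite [in X in X -> _]inE => /andP[zS /eqP hz].
  have /and3P[_] := hP _ zS; rewrite hz => xz _.
  by rewrite inE xz andbT; move: zS; rewrite !inE => /andP[/andP[]].
(* 16 = 8 * 2: the random set costs a factor 8, the grouping a factor 2. *)
- have : 16 * k * t * (trunc_log 2 #|T|).+1 <= (trunc_log 2 #|T|).+1 * (8 * #|S|).
    by apply: leq_trans le_Q (leq_trans le_Qj _); rewrite leq_mul2l le_Y orbT.
  by rewrite mulnC leq_pmul2l //; lia.
exists (fun i => [set y in S | g (h y) == i]) => // i l x y _ _ neq_il.
rewrite ![_ \in [set _ in S | _]]inE => /andP[xS /eqP gx] /andP[yS /eqP gy].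
(* If [x] is below [y], then [h x] lies in [D y :&: X], so [h x = h y] and the classes agree. *)
apply: contra neq_il => xy; rewrite -gx -gy.
have /and3P[hxQ hxx hxX] := hP _ xS.
have : h x \in D y :&: X by rewrite !inE hxQ hxX (r_trans _ _ _ hxx xy).
by rewrite hE // => /set1P->.
Qed.

Definition private_upset (T : finType) (r : rel T) (S : {set T}) (x : T) : {set T} :=
  [set y | r x y & [forall z in S, ~~ r z y]].

Definition antichain (T : finType) (r : rel T) (S : {set T}) : bool :=
  [forall x in S, forall y in S, (x != y) ==> ~~ r x y].

(** By transitivity, whatever lies above a point of [U(a i)] is in [U(a i)], which the private
    up-set of [a j] avoids. *)
Lemma thick_antichain_of_private_upsets (T : finType) (r : rel T) (t : nat)
    (S : {set T}) :
  transitive r ->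
  (forall x, x \in S -> t <= #|private_upset r (S :\ x) x|) ->
  thick_antichain r #|S| t.
Proof.
move=> r_trans big.
have [-> | [x0 _]] := set_0Vmem S; first by exists (fun=> set0); rewrite cards0.
pose a i := nth x0 (enum S) i.
have aS i : i < #|S| -> a i \in S.
  by move=> lt_i; rewrite -mem_enum mem_nth // -cardE.
exists (fun i => private_upset r (S :\ a i) (a i)) => [i /aS/big // |].
move=> i j x y lt_i lt_j neq_ij; rewrite !inE => /andP[ax _] /andP[_ /forall_inP priv].
have : ~~ r (a i) y.
  apply: priv; rewrite !inE aS // andbT.
  by rewrite nth_uniq ?enum_uniq // -cardE.
by apply: contra => xy; apply: r_trans xy.
Qed.

Lemma thick_antichain_of_many_antichains (T : finType) (r : rel T) (k t : nat) :
  reflexive r -> transitive r ->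
  'C(#|T|, k) * (16 * k.+1 * t * (trunc_log 2 #|T|).+1) <
    #|[set S : {set T} | (#|S| == k.+1) && antichain r S]| ->
  thick_antichain r k.+1 t.
Proof.
move=> r_refl r_trans; set M := 16 * _ * _ * _ => many.
pose out (S : {set T}) := [set y | [forall z in S, ~~ r z y]].
pose bad (S : {set T}) := [set x in out S | #|private_upset r S x| < t].
have [/existsP[S le_bad] | /existsPn small] := boolP [exists S, M <= #|bad S|].
  (* Points of [bad S] above [x] avoid the up-closure of [S], so they lie in the small private
     up-set of [x]. *)
  apply: (thick_antichain_of_small_upsets r_refl r_trans _ le_bad) => x.
  rewrite inE => /andP[_ /ltnW]; apply: leq_trans; apply: subset_leq_card.
  apply/subsetP => y; rewrite !inE.
  by move=> /andP[/andP[-> _] ->].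
have [/existsP[S /andP[/eqP <- /forall_inP big]] | /existsPn nobig] :=
  boolP [exists S : {set T}, (#|S| == k.+1) &&
           [forall x in S, t <= #|private_upset r (S :\ x) x|]].
  exact: thick_antichain_of_private_upsets.
suff : #|[set S : {set T} | (#|S| == k.+1) && antichain r S]| <= 'C(#|T|, k) * M.
  by rewrite leqNgt many.
(* Each antichain of size [k.+1] is [F] of some pair in [B], so [#|B|] bounds their number. *)
pose F (p : {set T} * T) := p.2 |: p.1.
pose B := [set p : {set T} * T | (#|p.1| == k) && (p.2 \in bad p.1)].
apply: (@leq_trans #|B|).
  apply: leq_trans (leq_imset_card F B); apply: subset_leq_card.
  apply/subsetP => S; rewrite inE => /andP[cardS anti].
  have := nobig S; rewrite cardS /= => /forall_inPn[x xS]; rewrite -ltnNge => lt_t.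
  apply/imsetP; exists (S :\ x, x); last by rewrite /F /= setD1K.
  rewrite !inE /= lt_t andbT; apply/andP; split.
    by move: cardS; rewrite (cardsD1 x) xS.
  apply/forall_inP => z; rewrite !inE => /andP[zx zS].
  by have /forall_inP/(_ z zS)/forall_inP/(_ x xS)/implyP := anti; apply.
rewrite -card_draws -sum_nat_const -sum1_card.
pose K := [set A : {set T} | #|A| == k].
rewrite (eq_bigl (fun p => (p.1 \in K) && (p.2 \in bad p.1))); last first.
  by move=> p; rewrite !inE.
rewrite -(pair_big_dep (mem K) (fun A x => x \in bad A) (fun _ _ => 1)) /=.
by apply: leq_sum => A _; rewrite sum1_card ltnW // ltnNge small.
Qed.

(** * Real estimates and the passage to graphs *)

Local Open Scope ring_scope.

Lemma trunc_log2_le_ln (R : realType) (n : nat) :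
  (2 <= n)%N -> (trunc_log 2 n).+1%:R <= 4 * ln (n%:R : R).
Proof.
move=> n_ge2.
have ln2 : 1 / 2 <= ln (2 : R).
  (* [ln (1 + x) <= x] at [x = -1/2]. *)
  have := @le_ln1Dx R (- (1 / 2)); rewrite (_ : 1 + _ = 2^-1); last by field.
  by rewrite lnV ?posrE // => /(_ _); lra.
have mono (m : nat) : (0 < m)%N -> (m <= n)%N -> ln (m%:R : R) <= ln n%:R.
  by move=> m_gt0 le_mn; rewrite ler_ln ?posrE ?ltr0n ?ler_nat //; lia.
have := mono (2 ^ trunc_log 2 n)%N; rewrite expn_gt0 trunc_logP //; last by lia.
move=> /(_ isT isT); rewrite natrX lnXn // -[_ *+ trunc_log _ _]mulr_natl => le_log.
have := mono 2%N isT n_ge2.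
have := ler_wpM2l (ler0n R (trunc_log 2 n)) ln2.
by rewrite -[(trunc_log 2 n).+1%:R]natr1; lra.
Qed.

(** Send [(i, a)] to the [a]-th element of [A i]. Images from different parts are adjacent, hence
    distinct by irreflexivity. *)
Lemma contains_copy_of_thick_antichain (G : sgraph) (r : rel G) (k t : nat) :
  (forall x y, adj x y = ~~ r x y && ~~ r y x) ->
  thick_antichain r k t -> contains_copy (blowup (complete_graph k) t) G.
Proof.
move=> adjE [A size_A incomp].
pose emb (p : 'I_k * 'I_t) : G := enum_val (widen_ord (size_A _ (ltn_ord p.1)) p.2).
have embA p : emb p \in A p.1 by apply: enum_valP.
have emb_adj p q : p.1 != q.1 -> adj (emb p) (emb q).
  move=> neq; rewrite adjE (incomp p.1 q.1) ?(incomp q.1 p.1) //.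
  by rewrite eq_sym.
exists emb => [[i a] [j b] eq_emb | p q]; last exact: emb_adj.
have eq_ij : i = j.
  apply/eqP; apply: contraT => neq_ij.
  by have := @emb_adj (i, a) (j, b) neq_ij; rewrite eq_emb adj_irrefl.
case: _ / eq_ij b eq_emb => b /enum_val_inj/(congr1 val)/= /val_inj->//.
Qed.

Theorem theorem1p6 (R : realType) (c : R) (k : nat)
  (hc0 : 0 < c) (hc1 : c < 1 / 2) (hk : (2 <= k)%N) :
  exists n0 : nat, forall (n : nat) (G : sgraph),
    (n0 <= n)%N -> #|G| = n ->
    is_incomparability_graph G ->
    c <= clique_density R k G ->
    contains_copy
      (blowup (complete_graph k)
         (Num.truncn (c ^+ 4 * n%:R / (10 ^+ 8 * k%:R ^+ 2 * ln n%:R))))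
      G.
Proof.
(* This bound gives [n >= 2], positive binomials and, below, [n <= 2(n - k)]. *)
exists (2 * k)%N => n G le_n cardG [d [P [f f_bij f_adj]]] dense.
pose r (x y : G) := (f x <= f y)%O.
have adjE x y : adj x y = ~~ r x y && ~~ r y x.
  by rewrite -f_adj /= /Order.comparable negb_or.
set t := Num.truncn _; apply: (contains_copy_of_thick_antichain adjE).
case: k hk le_n dense @t => // k hk le_n dense t.
apply: thick_antichain_of_many_antichains.
- by move=> x; apply: lexx.
- by move=> y x z; apply: le_trans.
have -> : #|[set S : {set G} | (#|S| == k.+1) && antichain r S]| = clique_count k.+1 G.
  apply: eq_card => S; rewrite !inE; congr (_ && _).
  apply/forall_inP/forall_inP => anti x xS; apply/forall_inP => y yS; apply/implyP => neq.
    have /forall_inP/(_ y yS)/implyP := anti x xS.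
    have /forall_inP/(_ x xS)/implyP := anti y yS.
    by rewrite adjE (eq_sym y x) => /(_ neq)-> /(_ neq)->.
  by have /forall_inP/(_ y yS)/implyP/(_ neq) := anti x xS; rewrite adjE => /andP[].
rewrite cardG -(ltr_nat R).
have n_ge2 : (2 <= n)%N by lia.
have le_kn : (k.+1 <= n)%N by lia.
have bin_gt : 0 < 'C(n, k.+1)%:R :> R by rewrite ltr0n bin_gt0.
have binp_gt : 0 < 'C(n, k)%:R :> R by rewrite ltr0n bin_gt0; lia.
move: dense; rewrite /clique_density cardG ler_pdivlMr //.
apply: lt_le_trans.
(* Trading ['C(n, k.+1)] for ['C(n, k)] lets the binomials cancel. *)
have binE : k.+1%:R * 'C(n, k.+1)%:R = (n%:R - k%:R) * 'C(n, k)%:R :> R.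
  by rewrite -natrM mul_bin_left natrM natrB //; lia.
have k_gt0 : 0 < k.+1%:R :> R by rewrite ltr0n.
rewrite -(ltr_pM2l k_gt0) [ltRHS]mulrCA binE.
rewrite !natrM mulrCA mulrCA.
have log_le := @trunc_log2_le_ln R n n_ge2.
set l := (_.+1)%:R in log_le *; set L := ln _ in log_le.
have L_gt0 : 0 < L by apply: ln_gt0; rewrite ltr1n.
have t_le : t%:R <= c ^+ 4 * n%:R / (10 ^+ 8 * k.+1%:R ^+ 2 * L) :> R.
  rewrite truncn_le divr_ge0 // ?mulr_ge0 ?exprn_ge0 //; exact: ltW.
rewrite ler_pdivlMr in t_le; last by rewrite !mulr_gt0 // exprn_gt0.
have c4 : c ^+ 4 * n%:R <= c * n%:R.
  apply: ler_wpM2r => //; rewrite -[leRHS]expr1; apply: ler_wiXn2l => //; lra.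
have n_half : n%:R <= 2 * (n%:R - k%:R) :> R.
  by have := le_n; rewrite -(ler_nat R) natrM -natr1; lra.
have coef_ge0 : 0 <= 16 * k.+1%:R ^+ 2 * t%:R :> R by rewrite !mulr_ge0 ?sqr_ge0.
have scale_le := ler_wpM2l coef_ge0 log_le.
have nk_gt0 : 0 < c * (n%:R - k%:R).
  by rewrite mulr_gt0 // subr_gt0 ltr_nat.
have cn_half := ler_wpM2l (ltW hc0) n_half.
(* With [l <= 4 L] the factor before ['C(n, k)] is at most [64 c n / 10^8 <= 128 c (n - k) / 10^8],
   well below [c (n - k)]. *)
rewrite [ltLHS](_ : _ = 16 * k.+1%:R ^+ 2 * t%:R * l * 'C(n, k)%:R); last by ring.
by rewrite [ltRHS]mulrA (ltr_pM2r binp_gt); lra.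
Qed.
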